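(* Let $p$ be a prime and $n\ge 1$. Every regular Cayley map of $G\cong \mathbb{Z}_p^n$ is isomorphic to an algebraic map $\mathcal{M}(T\rtimes\langle\sigma\rangle;\,\sigma,\,t(-I))$, where $\sigma\in \mathbf{M}(n,p)$ and $t$ may be taken to be any element of $T$ such that $\{\sigma^i(t)\mid 0\le i\le n-1\}$ is a basis of $T$. Moreover, for given $p$ and $n$, different elements $\sigma$ of $\mathbf{M}(n,p)$ give nonisomorphic maps.
   Context: A Cayley map $\mathrm{CM}(G,S,\rho)$ ($S\subseteq G\setminus\{1\}$ an inverse-closed generating set, $\rho$ a cyclic permutation of $S$) is the embedding of $\mathrm{Cay}(G,S)$ into an orientable surface with local rotation $(g,gs)\mapsto (g,g\rho(s))$ at every vertex; it is regular if its orientation-preserving automorphism group acts regularly on arcs. Algebraic maps: for a finite group $X=\langle r,\ell\rangle$ with $\ell^2=1$, $\mathcal{M}(X;r,\ell)$ is the orientably-regular map whose darts are the elements of $X$ and whose vertices, edges and faces are the cosets of $\langle r\rangle$, $\langle \ell\rangle$ and $\langle r\ell\rangle$ respectively, with incidence given by inclusion/intersection; $r$ corresponds to the local rotation and $\ell$ to arc reversal. Two algebraic maps $\mathcal{M}(X_1;r_1,\ell_1)$ and $\mathcal{M}(X_2;r_2,\ell_2)$ are isomorphic iff there is a group isomorphism $X_1\to X_2$ sending $r_1\mapsto r_2$ and $\ell_1\mapsto \ell_2$. A regular Cayley map with automorphism group $X$, point-stabiliser $\langle\sigma\rangle$ and arc-reversing involution $\ell$ is represented as $\mathcal{M}(X;\sigma,\ell)$.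 Notation: $T$ is the translation subgroup of $\mathrm{AGL}(n,p)=T\rtimes \mathrm{GL}(n,p)$, identified with the row space $V(n,p)=\mathbb{F}_p^n$; an element $\sigma\in\mathrm{GL}(n,p)$ acts on $T$ by $\sigma^{-1}t\sigma=\sigma(t)$; $I$ is the identity, $-I$ the negation map (so $-I=I$ when $p=2$), and $t(-I)$ is the product of $t\in T$ and $-I$ in $T\rtimes\langle\sigma\rangle\le \mathrm{AGL}(n,p)$. $\mathbf{M}(n,p)$ is a set of representatives of the conjugacy classes (in $\mathrm{GL}(n,p)$) of those $\sigma\in\mathrm{GL}(n,p)$ whose minimal polynomial has degree $n$ and such that $-I\in\langle\sigma\rangle$. *)

(* Defs.v *)
From HB Require Import structures.
From mathcomp Require Import all_boot all_order all_fingroup all_algebra.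
From mathcomp Require Import all_solvable all_field all_character.

Set Implicit Arguments.
Unset Strict Implicit.
Unset Printing Implicit Defensive.

Import GRing.Theory.
Local Open Scope group_scope.

(* A map on an orientable surface is encoded by the rotation and the arc
   reversal on its darts (arcs); only the values on [darts] are meaningful.
   The vertices, edges and faces are the orbits in [darts] of [rot], of [rev],
   and of the rotation followed by the reversal. *)
Record omap := OMap {
  carrier : finType;
  darts : {set carrier};
  rot : carrier -> carrier;
  rev : carrier -> carrier
}.

(* Isomorphisms preserve the orientation. *)
Definition omap_iso (M N : omap) : Prop :=
  exists f : carrier M -> carrier N,
    [/\ {in darts M &, injective f},
        f @: darts M = darts N,
        {in darts M, forall d, f (rot d) = rot (f d)} &
        {in darts M, forall d, f (rev d) = rev (f d)}].

(* Requiring the support to lie in [darts M] makes each automorphism of the map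
   occur exactly once. *)
Definition omap_aut (M : omap) : {set {perm carrier M}} :=
  [set f : {perm carrier M} | perm_on (darts M) f &
     [forall d in darts M, (f (rot d) == rot (f d)) && (f (rev d) == rev (f d))]].

Definition regular_omap (M : omap) : Prop :=
  [transitive omap_aut M, on darts M | 'P]
  /\ {in darts M, forall d, 'C_(omap_aut M)[d | 'P] = 1}.

Section CayleyMap.

Variables (gT : finGroupType) (S : {set gT}) (rho : {perm gT}).

(* The permutation of S is represented by its extension by the identity. *)
Definition cayley_data : Prop :=
  [/\ 1 \notin S, S^-1 = S, <<S>> = [set: gT],
      perm_on S rho & {in S, forall s, porbit rho s = S}].

(* The dart (g, h) is the arc from g to h of Cay(G, S). *)
Definition cayley_map : omap :=
  @OMap (gT * gT)%type
    [set a | a.1^-1 * a.2 \in S]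
    (fun a => (a.1, a.1 * rho (a.1^-1 * a.2)))
    (fun a => (a.2, a.1)).

End CayleyMap.

Section AlgebraicMap.

Variables (xT : finGroupType) (X : {group xT}) (r l : xT).

Definition alg_data : Prop := <<[set r; l]>> = X /\ l ^+ 2 = 1.

(* The vertices, edges and faces are the left cosets in X of the subgroups
   <[r]>, <[l]> and <[r * l]>. *)
Definition alg_map : omap :=
  @OMap xT X (fun x => x * r) (fun x => x * l).

End AlgebraicMap.

(* The dimension is n.+1, as {'GL_n(p)} consists of matrices of size n.-1.+1. *)
Section AGL.

Variables n p : nat.

Local Notation V := 'rV['F_p]_n.+1.

(* AGL(n.+1, p), with GL(n.+1, p) acting on row vectors by right multiplication. *)
Definition AGL : finGroupType :=
  sdprod_groupType ('MR (GLrepr 'F_p n))%gact.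

Definition transl (t : V) : AGL := sdpair1 ('MR (GLrepr 'F_p n))%gact t.
Definition lin (s : {'GL_n.+1(p)}) : AGL := sdpair2 ('MR (GLrepr 'F_p n))%gact s.

Definition translations : {group AGL} :=
  (sdpair1 ('MR (GLrepr 'F_p n))%gact @* [set: V])%G.

Definition AGLsub (s : {'GL_n.+1(p)}) : {group AGL} :=
  (translations <*> <[lin s]>)%G.

Lemma transl_conj (t : V) (s : {'GL_n.+1(p)}) :
  (lin s)^-1 * transl t * lin s = transl (t *m GLval s)%R.
Proof.
by rewrite -mulgA -conjgE -sdpair_act ?inE //= mx_repr_actE ?inE.
Qed.

Lemma AGLsubE s : translations ><| <[lin s]> = AGLsub s.
Proof.
have D1 : s \in 'GL_n.+1(p) by rewrite inE.
have sub : <[lin s]> \subset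
    sdpair2 ('MR (GLrepr 'F_p n))%gact @* 'GL_n.+1(p).
  by rewrite cycle_subG mem_morphim.
case/sdprodP: (sdprod_sdpair ('MR (GLrepr 'F_p n))%gact) => _ _ nT tiT.
rewrite sdprodEY ?(subset_trans sub) //.
by apply/trivgP; rewrite -tiT setIS.
Qed.

Definition negI : {'GL_n.+1(p)} :=
  FinRing.unit 'M['F_p]_n.+1 (unitrN1 _).

Definition cyclicGL : {set {'GL_n.+1(p)}} :=
  [set s : {'GL_n.+1(p)} | degree_mxminpoly (GLval s) == n.+1 & negI \in <[s]>].

Definition class_reps (M : {set {'GL_n.+1(p)}}) : bool :=
  is_transversal M [set s ^: 'GL_n.+1(p) | s in cyclicGL] cyclicGL.

Definition orbit_basis (s : {'GL_n.+1(p)}) (t : V) : bool :=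
  basis_of fullv [seq (t *m GLval (s ^+ i)%g)%R | i <- iota 0 n.+1].

Definition sigma_ell (t : V) : AGL := transl t * lin negI.

Definition sigma_map (s : {'GL_n.+1(p)}) (t : V) : omap :=
  alg_map (AGLsub s) (lin s) (sigma_ell t).

End AGL.

(* Main.v *)
Require Import Defs.
From mathcomp Require Import all_boot all_order all_fingroup all_algebra.
From mathcomp Require Import all_solvable all_field all_character.
From Stdlib Require Import Classical.

(* The automorphism group X of a regular Cayley map of G = Z_p^n factors as
   X = G <[r]> with <[r]> core-free, and X = <[r, l]> with l an involution. By
   Ito's theorem K = X' is abelian, and l inverts [l, r], hence inverts K. So
   K :&: <[r]> is normal in X, hence trivial, and K <[r]> has index at most 2.
   Comparing G :&: K with K shows that K has exponent p; then T = K, or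
   T = K <[l]> when p = 2 and the index is 2, is an elementary abelian normal
   complement of <[r]>, and X embeds in AGL(n, p) with r mapped to a linear map
   s. Writing l = t c with t in T and c in <[r]>, the relation l^2 = 1 makes c
   invert t, which generates T as an <[r]>-module, so c = -I, t is a cyclic
   vector and the minimal polynomial of s has degree n. Any two cyclic vectors
   are exchanged by an element of the centraliser of s. Conversely a map
   isomorphism is induced by a group isomorphism fixing -I, the involution of
   the cyclic group <[s]>; it therefore matches the translations t, and so
   restricts to a linear map conjugating the two matrices. *)

Set Implicit Arguments.
Unset Strict Implicit.
Unset Printing Implicit Defensive.

Import GroupScope GRing.Theory.

(** * Derived subgroups of factorised and two-generator groups *)

(** Ito's theorem. The derived subgroup lies in [[~: A, B]], and conjugation by [c * d] and by
    [d * c] agree on the commutators [[~ a, b]], so these commute with every [[~ c, d]]. *)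
Lemma der1_mul_abelian (gT : finGroupType) (A B X : {group gT}) :
  abelian A -> abelian B -> A * B = X -> abelian X^`(1).
Proof.
move=> cAA cBB defX.
have defX' : B * A = X
  by rewrite -defX; apply/esym/comm_group_setP; rewrite defX groupP.
have [sAX sBX] : A \subset X /\ B \subset X by rewrite -defX mulG_subl mulG_subr.
have commR a b c d : a \in A -> b \in B -> c \in A -> d \in B ->
  [~ a, b] ^ (c * d) = [~ a, b] ^ (d * c).
  move=> Aa Bb Ac Bd.
  (* With [b ^ c = a2 * b2] and [a ^ d = b3 * a3], both conjugates reduce to [[~ a3, b2]]. *)
  have /mulsgP[a2 b2 Aa2 Bb2 e2] : b ^ c \in A * B.
    by rewrite defX groupJ ?(subsetP sAX c) ?(subsetP sBX b).
  have /mulsgP[b3 a3 Bb3 Aa3 e3] : a ^ d \in B * A.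
    by rewrite defX' groupJ ?(subsetP sBX d) ?(subsetP sAX a).
  have cA x y : x \in A -> y \in A -> [~ x, y] = 1.
    by move=> Ax Ay; apply/eqP/commgP/(centsP cAA).
  have cB x y : x \in B -> y \in B -> [~ x, y] = 1.
    by move=> Bx By; apply/eqP/commgP/(centsP cBB).
  have cAJ x y : x \in A -> y \in A -> x ^ y = x.
    by move=> Ax Ay; rewrite conjgE (centsP cAA x Ax y Ay) mulKg.
  have cBJ x y : x \in B -> y \in B -> x ^ y = x.
    by move=> Bx By; rewrite conjgE (centsP cBB x Bx y By) mulKg.
  rewrite !conjgM !(conjRg a b) (cAJ a c) // (cBJ b d) // e2 e3.
  rewrite commgMJ (cA a a2) // conj1g mulg1 conjRg e3 (cBJ b2 d) //.
  rewrite !commMgJ (cB b3) // (cB b3 b) // !conj1g !mul1g conjRg (cAJ a3 c) // e2.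
  by rewrite commgMJ (cA a3 a2) // conj1g mulg1.
have cRR : abelian [~: A, B].
  rewrite abelian_gen; apply/centsP=> _ /imset2P[a b Aa Bb ->].
  move=> _ /imset2P[c d Ac Bd ->]; apply/commgP; apply/conjg_fixP.
  have -> : [~ c, d] = (c^-1 * d^-1) * (c * d) by rewrite commgEl conjgE !mulgA.
  rewrite conjgM commR ?groupV // -conjgM !mulgA mulgKV mulVg conjg1 //.
apply: abelianS cRR; apply: der1_min.
  by rewrite -defX mulG_subG commg_norml commg_normr.
rewrite -defX quotientMl ?commg_norml // abelianM !quotient_abelian //=.
by rewrite quotient_cents2 ?commg_norml ?commg_normr // commGC.
Qed.

Section TwoGenerators.

Variables (gT : finGroupType) (X : {group gT}) (r l : gT).
Hypothesis genX : <<[set r; l]>> = X.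

Let Xr : r \in X. Proof. by rewrite -genX mem_gen ?set21. Qed.
Let Xl : l \in X. Proof. by rewrite -genX mem_gen ?set22. Qed.

Lemma gen2_der1_sub (H : {group gT}) :
  r \in 'N(H) -> l \in 'N(H) -> [~ l, r] \in H -> X^`(1) \subset H.
Proof.
move=> Nr Nl Hu.
have sN : [set r; l] \subset 'N(H) by apply/subsetP=> x /set2P[]->.
apply: der1_min; first by rewrite -genX gen_subG.
rewrite -genX quotient_gen // abelian_gen /quotient morphimU !morphim_set1 //.
have cc : commute (coset H l) (coset H r).
  by apply/commgP; rewrite -morphR //= coset_id.
by apply/centsP=> x /set2P[]-> y /set2P[]->.
Qed.

Hypothesis (l2 : l ^+ 2 = 1) (cKK : abelian X^`(1)).

(** Since the derived subgroup is abelian, its elements inverted by [l] form a subgroup; this is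
    normalised by [r] and [l] and contains [[~ l, r]], so it is everything. *)
Lemma involution_inverts_der1 : {in X^`(1), forall x, x ^ l = x^-1}.
Proof.
have K_r x : x \in X^`(1) -> x ^ r \in X^`(1).
  by move=> Kx; rewrite memJ_norm // (subsetP (der_norm 1 X)).
have Kc x y : x \in X^`(1) -> y \in X^`(1) -> x ^ y = x.
  by move=> Kx Ky; rewrite conjgE (centsP cKK x Kx y Ky) mulKg.
have gH : group_set [set x in X^`(1) | x ^ l == x^-1].
  apply/group_setP; split; first by rewrite !inE group1 conj1g invg1 /=.
  move=> x y; rewrite !inE => /andP[Kx /eqP ex] /andP[Ky /eqP ey].
  by rewrite groupM //= conjMg ex ey -invMg (centsP cKK y Ky x Kx).
suff /subsetP sKH : X^`(1) \subset Group gH.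
  by move=> x /sKH; rewrite inE => /andP[_ /eqP].
have lV : l^-1 = l by apply/eqP; rewrite eq_invg_mul -expg2 l2.
apply: gen2_der1_sub.
(* [r * l] and [l * r] differ by a commutator, which acts trivially on the abelian derived
   subgroup. *)
- rewrite inE; apply/subsetP=> _ /imsetP[x + ->]; rewrite !inE => /andP[Kx /eqP ex].
  rewrite K_r //= -conjgM commgC conjgM conjgM ex !conjVg Kc ?K_r //.
  by rewrite derg1 mem_commg.
- rewrite inE; apply/subsetP=> _ /imsetP[x + ->]; rewrite !inE => /andP[Kx /eqP ex].
  by rewrite ex groupV Kx conjVg ex eqxx.
(* [[~ l, r] = l * l ^ r] is a product of two elements of square 1, and conjugation by [l] swaps the
   factors. *)
- have bV : (l ^ r)^-1 = l ^ r by rewrite -conjVg lV.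
  rewrite inE derg1 mem_commg //= commgEl lV invMg bV lV.
  by rewrite (conjgE (l * _)) lV mulgA mulgA -expg2 l2 mul1g.
Qed.

(** Normalisation by [l] comes for free, because [l] inverts every element of [H]. *)
Lemma gen2_der1_sub_inv (H : {group gT}) :
  H \subset X^`(1) -> r \in 'N(H) -> [~ l, r] \in H -> X^`(1) \subset H.
Proof.
move=> sHK Nr; apply: gen2_der1_sub => //.
rewrite inE; apply/subsetP=> _ /imsetP[x Hx ->].
by rewrite involution_inverts_der1 ?groupV ?(subsetP sHK).
Qed.

End TwoGenerators.

(** * Elementary abelian times core-free cyclic *)

Lemma maximal_mem_exp (gT : finGroupType) (K N : {group gT}) (p : nat) (z : gT) :
  abelian K -> maximal N K -> {in N, forall x, x ^+ p = 1} ->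
  z \in K -> z \notin N -> z ^+ p = 1 -> {in K, forall x, x ^+ p = 1}.
Proof.
move=> cKK maxN expN Kz N'z z1 x.
have sNK := maxgroupp (maxN : [max N | N \proper K]) => Kx.
have cNz : <[z]> \subset 'C(N).
  by rewrite cycle_subG (subsetP (subset_trans cKK (centS (proper_sub sNK)))).
have : N <*> <[z]> = K.
  have [_ maxN'] := maxgroupP maxN.
  have sJK : N <*> <[z]> \subset K by rewrite join_subG (proper_sub sNK) cycle_subG.
  apply/eqP; rewrite eqEproper sJK; apply/negP=> /maxN' e.
  by move: N'z; rewrite -e ?joing_subl // -cycle_subG joing_subr.
rewrite cent_joinEr // => defK; move: Kx; rewrite -defK => /mulsgP[n _ Nn /cycleP[i ->] ->].
rewrite expgMn ?(expN n Nn) ?mul1g; last first.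
  by apply: commuteX; apply/commute_sym/(centP (subsetP cNz z (cycle_id z))).
by rewrite -expgM mulnC expgM z1 expg1n.
Qed.

Section Factorization.

Variables (gT : finGroupType) (X G : {group gT}) (r l : gT) (p : nat).
Hypotheses (p_pr : prime p) (abelG : p.-abelem G) (defX : G * <[r]> = X).
Hypotheses (tiGC : G :&: <[r]> = 1) (genX : <<[set r; l]>> = X) (l2 : l ^+ 2 = 1).
Hypothesis corefree :
  forall B : {group gT}, B \subset <[r]> -> X \subset 'N(B) -> B :=: 1.
(** Cayley maps satisfy this by [cayley_rev_transl]: when p = 2 the arc reversal at the base dart is
    a translation. *)
Hypothesis Gl : p = 2 -> l \in G.

Let K := X^`(1)%G.
Let C := <[r]>%G.

Let Xr : r \in X. Proof. by rewrite -genX mem_gen ?set21. Qed.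
Let Xl : l \in X. Proof. by rewrite -genX mem_gen ?set22. Qed.
Let sGX : G \subset X. Proof. by rewrite -defX mulG_subl. Qed.
Let sCX : C \subset X. Proof. by rewrite -defX mulG_subr. Qed.
Let sKX : K \subset X. Proof. exact: der_sub. Qed.
Let nKX : X \subset 'N(K). Proof. exact: der_norm. Qed.

Let cGG : abelian G. Proof. exact: abelem_abelian abelG. Qed.
Let expG : {in G, forall x, x ^+ p = 1}.
Proof. by case/(abelemP p_pr): abelG. Qed.

Lemma factor_der1_abelian : abelian K.
Proof. exact: der1_mul_abelian cGG (cycle_abelian r) defX. Qed.
Let cKK := factor_der1_abelian.
Let invK := involution_inverts_der1 genX l2 cKK.

Lemma factor_der1_TI : K :&: C = 1.
Proof.
apply: (corefree (B := (K :&: C)%G)); first exact: subsetIr.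
rewrite -{1}genX gen_subG; apply/subsetP=> x /set2P[]->.
  rewrite (subsetP (normsI _ (normG C))) ?cycle_id //.
  exact: subset_trans sCX nKX.
rewrite inE; apply/subsetP=> _ /imsetP[z /setIP[Kz Cz] ->].
by rewrite invK // inE !groupV Kz.
Qed.

Let nKC : C \subset 'N(K). Proof. exact: subset_trans sCX nKX. Qed.

Let Y := (K <*> C)%G.
Let defY : K * C = Y. Proof. by rewrite /Y /= norm_joinEr. Qed.
Let sYX : Y \subset X. Proof. by rewrite join_subG sKX. Qed.
Let sKY : K \subset Y. Proof. exact: joing_subl. Qed.
Let sCY : C \subset Y. Proof. exact: joing_subr. Qed.

(** [Y] contains the derived subgroup, hence is normal, and [Y * <[l]>] is a subgroup containing
    both generators. *)
Lemma factor_der1_coset : Y * <[l]> = X.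
Proof.
have nYX : X \subset 'N(Y) by apply: sub_der1_norm.
have nYl : <[l]> \subset 'N(Y) by rewrite cycle_subG (subsetP nYX).
rewrite -norm_joinEr //; apply/eqP; rewrite eqEsubset join_subG sYX cycle_subG Xl /=.
suff: <<[set r; l]>> \subset Y <*> <[l]> by rewrite genX.
rewrite gen_subG; apply/subsetP=> x /set2P[]->.
  exact/(subsetP (joing_subl Y <[l]>))/(subsetP sCY)/cycle_id.
exact/(subsetP (joing_subr Y <[l]>))/cycle_id.
Qed.

Let H := (G :&: Y)%G.
Let N := (G :&: K)%G.

Let defH : H * C = Y.
Proof. by rewrite /H /= setIC group_modr // defX; apply/setIidPl. Qed.

(** By Dedekind's law [H] is, like [K], a complement of [C] in [Y]. *)
Let cardH : #|H| = #|K|.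
Proof.
have tiHC : H :&: C = 1 by apply/trivgP; rewrite -tiGC setSI ?subsetIl.
apply/eqP; rewrite -(eqn_pmul2r (cardG_gt0 C)).
by rewrite -!TI_cardMg ?factor_der1_TI // defH defY.
Qed.

(** If [H] is not inside [K], an element g = x t of [H] outside [K] shows that [N] has index p in
    [K]; it then suffices to find an element of [K] outside [N] with trivial p-th power. *)
Lemma factor_der1_exp : {in K, forall x, x ^+ p = 1}.
Proof.
have [sHK | /subsetPn[g Hg K'g]] := boolP (H \subset K).
  have /eqP <- : H == K :> {set gT} by rewrite eqEcard sHK cardH leqnn.
  by move=> x /setIP[/expG].
have [Gg Yg] := setIP Hg.
have /mulsgP[x t Kx Ct eg] : g \in K * C by rewrite defY.
have Nt := subsetP nKC t Ct; have Nx := subsetP (normG K) x Kx.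
have N'x : x \notin N.
  apply: contra K'g => /setIP[Gx _].
  suff t1 : t = 1 by rewrite eg t1 mulg1.
  by apply/set1gP; rewrite -tiGC inE Ct andbT -(groupMl _ Gx) -eg.
have expN : {in N, forall z, z ^+ p = 1} by move=> z /setIP[/expG].
(* [t = x^-1 * g], where x and g lie in the abelian groups [K] and [G], both of which contain
   [N]. *)
have ctN z : z \in N -> z ^ t = z.
  case/setIP=> Gz Kz; have -> : t = x^-1 * g by rewrite eg mulKg.
  rewrite conjgM (conjgE z) invgK mulgA (centsP cKK x Kx z Kz) mulgK.
  by rewrite conjgE mulgA (centsP cGG _ (groupVr Gg) z Gz) mulgKV.
have tp : t ^+ p = 1.
  apply/set1gP; rewrite -factor_der1_TI in_setI [X in _ && X]groupX // andbT.
  rewrite coset_idr ?groupX // morphX //=.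
  have -> : coset K t = coset K g by rewrite eg morphM //= (coset_id Kx) mul1g.
  by rewrite -morphX ?expG ?morph1 // eg groupM.
have sHN : H \subset 'N(K) by rewrite (subset_trans _ nKX) // subIset ?sGX.
(* The index is the order of [H / K], which is nontrivial, elementary abelian, and cyclic as a
   subgroup of [Y / K = C / K]. *)
have indexN : #|K : N| = p.
  have eN : H :&: K = N by rewrite /H /N /= -setIA (setIidPr sKY).
  rewrite -divgS ?subsetIr // -cardH -eN divgI -card_quotient //.
  rewrite (@cyclic_abelem_prime _ p) //.
  - by rewrite quotient_abelem // (abelemS (subsetIl _ _)).
  - apply: (@cyclicS _ (Y / K)%G); first exact/quotientS/subsetIr.
    have -> : (Y / K)%G = (C / K)%G by apply: val_inj; rewrite /= -defY quotientMidl.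
    exact/quotient_cyclic/cycle_cyclic.
  - by rewrite -subG1 quotient_sub1 //; apply/subsetPn; exists g.
have maxN : maximal N K by rewrite p_index_maximal ?subsetIr // indexN.
have nN : N <| K.
  by rewrite /normal subsetIr (subset_trans cKK) // cents_norm ?centS ?subsetIr.
have xpN : x ^+ p \in N.
  rewrite coset_idr ?groupX ?(subsetP (normal_norm nN)) // morphX ?(subsetP (normal_norm nN)) //=.
  apply/eqP; rewrite -order_dvdn -indexN -card_quotient ?normal_norm // order_dvdG //.
  by rewrite mem_quotient.
have x_p : x ^+ p = 1 -> {in K, forall z, z ^+ p = 1}.
  exact: maximal_mem_exp maxN expN Kx N'x.
(* For odd p, either y = [x, t] lies in N, and (x t)^p = 1 gives x^p = 1, or y
   has order p and generates K with N. *)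
have [p2 | p_odd] := even_prime p_pr; last first.
  pose y := [~ x, t].
  have Ky : y \in K by rewrite /y commgEl groupM ?groupV ?memJ_norm.
  have [Ny | N'y] := boolP (y \in N).
    (* As y commutes with x and t, the p-th power of x t is x^p t^p times [t, x] to the power C(p,
       2), which p divides. *)
    apply: x_p; have := expG Gg; rewrite eg expMg_Rmul; first last.
    - by rewrite -invg_comm; apply/commuteV/(centsP cKK).
    - by rewrite -invg_comm; apply/commuteV/commute_sym/commgP/conjg_fixP/ctN.
    rewrite tp mulg1 -invg_comm expgVn (_ : y ^+ _ = 1) ?invg1 ?mulg1 //.
    have /dvdnP[k ->] : p %| 'C(p, 2).
      by rewrite prime_dvd_bin // odd_prime_gt2.
    by rewrite mulnC expgM expN // expg1n.
  apply: (maximal_mem_exp cKK maxN expN Ky N'y).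
  (* The p-th power of y is the inverse of x^p times the conjugate of x^p by t, and t centralises
     x^p, an element of [N]. *)
  rewrite /y commgEl expgMn; last by apply: (centsP cKK); rewrite ?groupV ?memJ_norm.
  by rewrite expgVn -conjXg ctN // mulVg.
(* For p = 2, l commutes with g, so t^l = x^2 t with x^2 central; hence t
   commutes with [l, r], so with all of K, and g^2 = 1 gives x^2 = 1. *)
have Gl2 : l \in G by apply: Gl.
have lV : l^-1 = l by apply/eqP; rewrite eq_invg_mul -expg2 l2.
have x2N : x ^+ 2 \in N by rewrite -p2.
apply: x_p; rewrite p2.
have tl : t ^ l = x ^+ 2 * t.
  have : g ^ l = g by rewrite conjgE mulgA (centsP cGG _ (groupVr Gl2) g Gg) mulgKV.
  by rewrite eg conjMg invK // => /(canRL (mulKVg x)) ->; rewrite expg2 !mulgA.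
have Kxr : x ^ r \in K by rewrite memJ_norm // (subsetP nKX).
(* [K / N] has order 2: either x^r lies in [N] and x^2 = 1, or x^r = x m with m in [N] of square
   1. *)
have xr2 : (x ^+ 2) ^ r = x ^+ 2.
  have : coset N (x ^ r) \in [set 1; coset N x].
    have -> : [set 1; coset N x] = K / N.
      apply/eqP; rewrite eqEcard subUset !sub1set group1 mem_quotient //=.
      rewrite card_quotient ?normal_norm // indexN p2 cards2 eq_sym.
      suff -> : coset N x != 1 by [].
      by apply: contra N'x => /eqP e; rewrite coset_idr // (subsetP (normal_norm nN)).
    by rewrite mem_quotient.
  have nNK := subsetP (normal_norm nN).
  case/set2P=> exr.
    have Nxr : x ^ r \in N by rewrite coset_idr ?nNK.
    have e1 := expN _ Nxr; rewrite p2 -conjXg in e1.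
    by have /eqP := e1; rewrite conjg_eq1 => /eqP->; rewrite conj1g.
  have Nm : x^-1 * x ^ r \in N.
    apply: coset_idr; first by rewrite groupM ?groupV ?nNK.
    by rewrite morphM ?morphV ?groupV ?nNK //= exr mulVg.
  have := expN _ Nm; rewrite p2 expgMn; last by apply: (centsP cKK); rewrite ?groupV.
  by rewrite expgVn conjXg => /eqP; rewrite -eq_mulVg1 => /eqP.
have crt : commute r t by apply: (centsP (cycle_abelian r)) => //; apply: cycle_id.
(* [r] commutes with x^2 and t, hence with [t ^ l]; conjugating by [l] gives the claim. *)
have ctl : commute (r ^ l) t.
  have : r ^ l * (t ^ l) ^ l = (t ^ l) ^ l * r ^ l.
    rewrite -!conjMg tl; congr (_ ^ _); apply: commuteM crt.
    by apply: commute_sym; apply/commgP/conjg_fixP.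
  by rewrite -conjgM -expg2 l2 conjg1.
have ctu : t \in 'C[[~ l, r]].
  by apply/cent1P; rewrite commgEr conjVg; apply/commuteM/commute_sym=> //; apply/commuteV/commute_sym.
have cKt : K \subset 'C[t].
  have sub : 'C_K[t] \subset K by apply: subsetIl.
  suff sKC : K \subset 'C_K[t] by apply: subset_trans sKC (subsetIr _ _).
  apply: (gen2_der1_sub_inv genX l2 cKK sub); last first.
    by rewrite inE mem_commg //= cent1C.
  have : C \subset 'N('C_K[t]).
    rewrite normsI // (subset_trans _ (normG _)) // cycle_subG.
    exact/cent1P.
  by rewrite cycle_subG.
have := expG Gg; rewrite eg p2 expgMn; last by apply/cent1P/(subsetP cKt).
by rewrite -{2}p2 tp mulg1.
Qed.


Lemma factor_normal_complement : exists2 T : {group gT}, p.-abelem T & T ><| C = X.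
Proof.
have abelK : p.-abelem K by apply/abelemP=> //; split=> //; exact: factor_der1_exp.
have cardX : #|X| = (#|G| * #|C|)%N by rewrite -TI_cardMg // defX.
have [Yl | Y'l] := boolP (l \in Y).
  exists K => //; rewrite sdprodE // ?factor_der1_TI // defY.
  by rewrite -factor_der1_coset mulGSid ?cycle_subG.
have o_l : #[l] = 2.
  by apply: nt_prime_order => //; apply: contraNneq Y'l => ->.
have ti_l : Y :&: <[l]> = 1.
  by rewrite setIC prime_TIg ?cycle_subG // -orderE o_l.
have cardG2 : #|G| = (#|K| * 2)%N.
  apply/eqP; rewrite -(eqn_pmul2r (cardG_gt0 C)) -cardX -factor_der1_coset.
  by rewrite TI_cardMg // -defY TI_cardMg ?factor_der1_TI // [#|<[l]>%G|]o_l mulnAC.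
have p2 : p = 2.
  have pG := abelem_pgroup abelG.
  have := pgroupP pG 2 isT; rewrite cardG2 dvdn_mull // => /(_ isT).
  by rewrite inE => /eqP.
have Gl2 := Gl p2.
(* [l] inverts [K], and inversion is trivial in exponent 2. *)
have cKl : <[l]> \subset 'C(K).
  rewrite cycle_subG; apply/centP=> z Kz; apply/commute_sym/commgP/conjg_fixP.
  by rewrite invK //; apply/eqP; rewrite eq_invg_mul -expg2 -p2 factor_der1_exp.
have defT : K * <[l]> = K <*> <[l]> by rewrite cent_joinEr.
have nTX : X \subset 'N(K <*> <[l]>).
  by apply: sub_der1_norm; rewrite ?joing_subl // join_subG sKX cycle_subG.
exists (K <*> <[l]>)%G.
  have /cprod_abelem -> : K \* <[l]> = K <*> <[l]> by rewrite cprodEY.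
  by rewrite abelK cycle_abelem ?p_pr ?orbT // o_l p2.
(* [K <*> <[l]>] meets [Y] only in [K], because [<[l]>] meets [Y] trivially. *)
have tiTC : (K <*> <[l]>) :&: C = 1.
  apply/trivgP; rewrite -factor_der1_TI subsetI subsetIr andbT.
  have sTY : (K <*> <[l]>) :&: Y \subset K.
    by rewrite -defT -group_modl // [<[l]> :&: _]setIC ti_l mulg1.
  by apply: subset_trans sTY; rewrite setIS.
have cardT : #|K <*> <[l]>| = #|G|.
  rewrite -defT TI_cardMg ?cardG2 ?[#|<[l]>%G|]o_l //.
  by apply/trivgP; rewrite -ti_l setSI.
rewrite sdprodE ?(subset_trans sCX) //=.
apply/eqP; rewrite eqEcard mulG_subG sCX join_subG sKX cycle_subG Xl /=.
by rewrite TI_cardMg //= cardT cardX.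
Qed.

End Factorization.

(** * Cyclic vectors *)

Section CyclicVectors.
Local Open Scope ring_scope.

Variable F : fieldType.

(** Strong induction on the size; excluded middle decides whether [d] has a nonconstant divisor of
    smaller size. *)
Lemma irreducible_divisor (d : {poly F}) :
  (1 < size d)%N -> exists2 e, irreducible_poly e & e %| d.
Proof.
have [m] := ubnP (size d); elim: m d => // m IHm d le_d d_gt1.
have [[e [/andP[e_gt1 e_lt] e_d]] | irr_d] :=
  classic (exists e : {poly F}, (1 < size e < size d)%N /\ e %| d).
  have [f irr_f f_e] := IHm e (leq_trans e_lt le_d) e_gt1.
  by exists f => //; apply: dvdp_trans e_d.
exists d => //; split=> // q q_neq1 q_d.
have d0 : d != 0 by rewrite -size_poly_gt0 ltnW.
have q0 : q != 0 by apply: contraTneq q_d => ->; rewrite dvd0p.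
rewrite -dvdp_size_eqp //; have := dvdp_leq d0 q_d.
rewrite leq_eqVlt => /orP[//|q_lt]; case: irr_d; exists q.
by rewrite q_lt andbT ltn_neqAle eq_sym q_neq1 size_poly_gt0.
Qed.

Lemma dvdp_exp_decomp (e d : {poly F}) : (1 < size e)%N -> d != 0 ->
  exists b g, d = e ^+ b * g /\ ~~ (e %| g).
Proof.
move=> e_gt1; have [m] := ubnP (size d); elim: m d => // m IHm d le_d d_neq0.
have [/dvdpP[g dE]|] := boolP (e %| d); last by exists 0%N, d; rewrite expr0 mul1r.
have e0 : e != 0 by rewrite -size_poly_gt0 ltnW.
have g0 : g != 0 by apply: contraNneq d_neq0 => g0; rewrite dE g0 mul0r.
have [|b [g' [gE ?]]] := IHm g _ g0.
  move: le_d; rewrite dE size_mul // ltnS; apply: leq_trans.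
  by case: (size e) e_gt1 => [|[|k]] // _; rewrite !addnS /= ltnS leq_addr.
by exists b.+1, g'; rewrite dE gE exprSr -mulrA [g' * e]mulrC mulrA.
Qed.

Variables (n : nat) (A : 'M[F]_n.+1).
Implicit Types (u v w : 'rV[F]_n.+1) (q d : {poly F}).

Local Notation "v \@ q" := (v *m horner_mx A q) (at level 40).

Lemma vhornerM v p q : (v \@ (p * q)) = ((v \@ p) \@ q).
Proof. by rewrite rmorphM /= -mulmxA. Qed.

Lemma vhornerC v p q : ((v \@ p) \@ q) = ((v \@ q) \@ p).
Proof. by rewrite -!vhornerM mulrC. Qed.

(* Induction on d: peel off a primary factor e^b, and add to a vector with
   annihilator d / e^b one with annihilator e^b. *)
Lemma annihilator_dvd d : d %| mxminpoly A ->
  exists v, forall q, ((v \@ q) == 0) = (d %| q).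
Proof.
have m0 : mxminpoly A != 0 := monic_neq0 (mxminpoly_monic A).
have [m] := ubnP (size d); elim: m d => // m IHm d le_d d_m.
have d0 : d != 0 by apply: contraTneq d_m => ->; rewrite dvd0p.
have [d_le1 | d_gt1] := leqP (size d) 1.
  exists 0 => q; rewrite mul0mx eqxx; apply/esym.
  have : size d == 1%N by rewrite eqn_leq d_le1 size_poly_gt0.
  by rewrite size_poly_eq1 => /eqp_dvdl->; rewrite dvd1p.
have [e irr_e e_d] := irreducible_divisor d_gt1.
have e_gt1 : (1 < size e)%N by case: irr_e.
have [b [g [dE Ng]]] := dvdp_exp_decomp e_gt1 d0.
have [k mE] := dvdpP _ _ d_m.
case: b => [|b] in dE; first by rewrite expr0 mul1r in dE; rewrite -dE e_d in Ng.
have e0 : e != 0 by apply: irredp_neq0.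
have g0 : g != 0 by apply: contraNneq d0 => g0; rewrite dE g0 mulr0.
have [||v annv] := IHm g.
- move: le_d; rewrite dE ltnS; apply: leq_trans.
  rewrite size_mul ?expf_neq0 // -[size (e ^+ _)]prednK ?size_poly_gt0 ?expf_neq0 //.
  rewrite size_exp addSn /= -[X in (X < _)%N]add0n ltn_add2r muln_gt0 andbT.
  by rewrite -ltnS prednK // ltnW.
- by rewrite mE dE !dvdp_mull.
have ceg : coprimep (e ^+ b.+1) g by apply: coprimep_expl; rewrite irreducible_poly_coprime.
(* The minimal polynomial [k * (e ^+ b.+1 * g)] does not divide [k * (e ^+ b * g)], so the latter is
   nonzero at [A] and some standard basis vector survives. *)
have [w0 w0P] : exists w0, (w0 \@ (k * (e ^+ b * g))) != 0.
  have /matrix0Pn[i [j Mij]] : horner_mx A (k * (e ^+ b * g)) != 0.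
    have k0 : k != 0 by apply: contraNneq m0 => k0; rewrite mE k0 mul0r.
    rewrite -dvd_mxminpoly mE dE dvdp_mul2l // dvdp_mul2r //.
    by rewrite dvdp_Pexp2l // ltnn.
  by exists (delta_mx 0 i); rewrite -rowE; apply/matrix0Pn; exists 0, j; rewrite mxE.
pose w := (w0 \@ (k * g)).
have w1 : (w \@ (e ^+ b.+1)) = 0.
  rewrite -vhornerM -mulrA [g * _]mulrC -dE -mE.
  by rewrite mx_root_minpoly mulmx0.
have w2 : (w \@ (e ^+ b)) != 0.
  by rewrite -vhornerM -mulrA [g * _]mulrC.
(* Write [q = e ^+ j * q'] with [q'] prime to [e]. If [j <= b], then [q'] and [e ^+ b.+1] both kill
   [w \@ (e ^+ b)], which by Bezout contradicts [w2]. *)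
have annw q : (w \@ q) = 0 -> e ^+ b.+1 %| q.
  move=> wq0; apply/idPn => Nq.
  have q0 : q != 0 by apply: contraNneq Nq => ->; rewrite dvdp0.
  have [j [q' [qE Nq']]] := dvdp_exp_decomp e_gt1 q0.
  have le_jb : (j <= b)%N.
    rewrite leqNgt; apply: contra Nq => lt_bj.
    by rewrite qE dvdp_mulr // dvdp_exp2l.
  have /Bezout_coprimepP[[a c] /= acP] : coprimep q' (e ^+ b.+1).
    by rewrite coprimep_expr // coprimep_sym irreducible_poly_coprime.
  have wbq : ((w \@ (e ^+ b)) \@ q') = 0.
    rewrite -(subnK le_jb) exprD -[LHS]vhornerM -mulrA -qE mulrC vhornerM.
    by rewrite wq0 mul0mx.
  have /dvdpP[x x1] : a * q' + c * e ^+ b.+1 %| 1 by rewrite (eqp_dvdl _ acP).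
  have wb0 : ((w \@ (e ^+ b)) \@ (a * q' + c * e ^+ b.+1)) = 0.
    rewrite rmorphD mulmxDr [a * _]mulrC vhornerM wbq mul0mx add0r.
    by rewrite [c * _]mulrC vhornerM [X in X *m _]vhornerC w1 !mul0mx.
  case/eqP: w2; have -> : (w \@ (e ^+ b)) = ((w \@ (e ^+ b)) \@ 1) by rewrite rmorph1 mulmx1.
  by rewrite x1 mulrC vhornerM wb0 mul0mx.
exists (v + w) => q; apply/eqP/idP=> [vwq | /dvdpP[q' ->]].
  (* Applying [g] removes the contribution of [v], so [e ^+ b.+1] divides [q * g], hence [q]; then
     [w] drops out and [g] divides [q]. *)
  have dw : e ^+ b.+1 %| q.
    have : e ^+ b.+1 %| q * g.
      apply: annw; rewrite vhornerM; have := congr1 (fun u => (u \@ g)) vwq.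
      rewrite mulmxDl mulmxDl mul0mx [((v \@ q) \@ g)]vhornerC.
      have /eqP-> : v \@ g == 0 by rewrite annv dvdpp.
      by rewrite mul0mx add0r.
    by rewrite Gauss_dvdpl // coprimep_sym.
  rewrite dE Gauss_dvdp // dw -annv; apply/eqP.
  have /dvdpP[q'' qE] := dw.
  by move: vwq; rewrite mulmxDl {2}qE mulrC vhornerM w1 mul0mx addr0.
rewrite mulmxDl dE [X in X + _](_ : _ = 0) ?add0r; last first.
  by apply/eqP; rewrite annv mulrA dvdp_mull.
by rewrite mulrCA vhornerM w1 mul0mx.
Qed.

Lemma cyclic_vector : exists v, forall q, ((v \@ q) == 0) = (mxminpoly A %| q).
Proof. exact: annihilator_dvd. Qed.

Lemma vhorner_poly v m (k : nat -> F) :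
  v \@ (\poly_(i < m) k i) = \sum_(i < m) k i *: (v *m A ^+ i).
Proof.
rewrite poly_def linear_sum /= mulmx_sumr; apply: eq_bigr => i _.
by rewrite linearZ /= rmorphXn /= horner_mx_X scalemxAr.
Qed.

Definition krylov m v : m.-tuple 'rV[F]_n.+1 :=
  [tuple of [seq v *m A ^+ i | i <- iota_tuple m 0]].

Lemma krylovE m v (i : 'I_m) : (krylov m v)`_i = v *m A ^+ i.
Proof. by rewrite (nth_map 0%N) ?size_iota // nth_iota. Qed.

Lemma dim_fullrow : \dim {: 'rV[F]_n.+1} = n.+1.
Proof. by rewrite dimvf /dim /= mul1n. Qed.

(** A linear relation between the Krylov vectors is a polynomial of size at most [n.+1] killing [v],
    hence a multiple of the minimal polynomial, of size [n.+2]. *)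
Lemma basis_krylov v : (forall q, (v \@ q == 0) = (mxminpoly A %| q)) ->
  degree_mxminpoly A = n.+1 -> basis_of fullv (krylov n.+1 v).
Proof.
move=> annv dA; rewrite basisEfree subvf size_tuple dim_fullrow leqnn !andbT.
apply/freeP=> k k0 i; pose q := \poly_(j < n.+1) k (inord j).
have q0 : q = 0.
  apply/eqP; apply: contraTT isT => q_neq0.
  have mq : mxminpoly A %| q.
    rewrite -annv vhorner_poly -[X in _ == X]k0; apply/eqP/eq_bigr => j _.
    by rewrite krylovE inord_val.
  have := leq_trans (dvdp_leq q_neq0 mq) (size_poly _ _).
  by rewrite size_mxminpoly dA ltnn.
by have := coef_poly n.+1 (fun j => k (inord j)) i; rewrite -/q q0 coef0 ltn_ord inord_val.
Qed.

Lemma krylov_basis_gen v w : basis_of fullv (krylov n.+1 v) -> exists q, w = v \@ q.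
Proof.
move=> Bv; exists (\poly_(i < n.+1) coord (krylov n.+1 v) (inord i) w).
rewrite {1}(coord_basis Bv (memvf w)) vhorner_poly; apply: eq_bigr => i _.
by rewrite krylovE inord_val.
Qed.

(** Reduction modulo the minimal polynomial, of degree d, shows that d Krylov vectors span, so
    [d >= n.+1]; the converse bound is Cayley-Hamilton. *)
Lemma gen_krylov_basis v : (forall w, exists q, w = v \@ q) ->
  degree_mxminpoly A = n.+1 /\ basis_of fullv (krylov n.+1 v).
Proof.
move=> genv; pose d := degree_mxminpoly A.
have span_d : (fullv <= <<krylov d v>>)%VS.
  apply/subvP=> w _; have [q ->] := genv w.
  have -> : v \@ q = v \@ (q %% mxminpoly A).
    rewrite {1}(divp_eq q (mxminpoly A)) rmorphD rmorphM /= mx_root_minpoly.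
    by rewrite mulr0 add0r.
  have le_d := size_mod_mxminpoly A q.
  have -> : q %% mxminpoly A = \poly_(i < d) (q %% mxminpoly A)`_i.
    apply/polyP=> i; rewrite coef_poly; case: ltnP => // le_di.
    by rewrite nth_default // (leq_trans le_d).
  rewrite vhorner_poly rpred_sum // => i _; rewrite rpredZ // -krylovE.
  by rewrite memv_span // mem_nth // size_tuple.
have d_n : d = n.+1.
  apply/eqP; rewrite eqn_leq -ltnS -size_mxminpoly -(size_char_poly A).
  rewrite dvdp_leq ?mxminpoly_dvd_char ?monic_neq0 ?char_poly_monic //=.
  by rewrite -dim_fullrow (leq_trans (dimvS span_d)) // (leq_trans (dim_span _)) ?size_tuple.
split=> //; rewrite basisEdim size_tuple dim_fullrow leqnn andbT.
by move: span_d; rewrite d_n.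
Qed.

(** Take for [h] the polynomial in [A] sending [v] to [w]; a polynomial sending [w] back to [v]
    gives its inverse, since [v] generates the whole space. *)
Lemma krylov_basis_conj v w :
  basis_of fullv (krylov n.+1 v) -> basis_of fullv (krylov n.+1 w) ->
  exists h, [/\ h \in unitmx, A *m h = h *m A & v *m h = w].
Proof.
move=> Bv Bw; have [q qE] := krylov_basis_gen w Bv; have [q' q'E] := krylov_basis_gen v Bw.
exists (horner_mx A q); split=> //; last first.
  by have := rmorphM (horner_mx A) 'X q; rewrite mulrC rmorphM /= horner_mx_X.
suff /mulmx1_unit[] : horner_mx A q *m horner_mx A q' = 1%:M by [].
apply/row_matrixP=> i; rewrite !rowE; have [x ->] := krylov_basis_gen (delta_mx 0 i) Bv.
by rewrite mulmx1 mulmxA [_ \@ x \@ q]vhornerC -qE vhornerC -q'E.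
Qed.

End CyclicVectors.

(** * The affine group *)

Lemma omap_iso_trans (M N P : Defs.omap) : omap_iso M N -> omap_iso N P -> omap_iso M P.
Proof.
case=> f [injf imf fr fl] [g [injg img gr gl]].
have fN d : d \in darts M -> f d \in darts N by move=> Md; rewrite -imf imset_f.
exists (g \o f); split=> [x y Mx My /injg|||] /=.
- by move/(_ (fN x Mx) (fN y My)); apply: injf.
- by rewrite imset_comp imf.
- by move=> d Md; rewrite fr // gr ?fN.
- by move=> d Md; rewrite fl // gl ?fN.
Qed.

Lemma injm_alg_map_iso (aT rT : finGroupType) (X : {group aT}) (Y : {group rT})
    (f : {morphism X >-> rT}) (r l : aT) :
  'injm f -> f @* X = Y -> r \in X -> l \in X ->
  omap_iso (alg_map X r l) (alg_map Y (f r) (f l)).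
Proof.
move=> injf imf Xr Xl; exists f; split=> /= [||x Xx|x Xx].
- exact/injmP.
- by rewrite -morphimEdom.
- exact: morphM.
- exact: morphM.
Qed.

Section AffineGroup.

Variables n p : nat.
Local Notation V := 'rV['F_p]_n.+1.
Implicit Types (s h : {'GL_n.+1(p)}) (t u v : V).

Lemma lin_morphM : {morph @lin n p : s h / s * h}.
Proof. by move=> s h; rewrite /lin morphM ?inE. Qed.

Lemma lin1 : @lin n p 1 = 1.
Proof. exact: morph1. Qed.

Lemma linX s i : lin s ^+ i = lin (s ^+ i).
Proof. by rewrite /lin morphX ?inE. Qed.

Lemma linV s : (lin s)^-1 = lin s^-1.
Proof. by rewrite /lin morphV ?inE. Qed.

Lemma lin_inj : injective (@lin n p).
Proof.
move=> s h; have /injmP inj := injm_sdpair2 ('MR (GLrepr 'F_p n))%gact.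
by apply: inj; rewrite inE.
Qed.

Lemma translD u v : transl (u + v)%R = transl u * transl v.
Proof. by rewrite /transl -morphM ?inE. Qed.

Lemma transl0 : transl (0 : V)%R = 1.
Proof. exact: morph1. Qed.

Lemma translN u : transl (- u)%R = (transl u)^-1.
Proof. by apply/eqP; rewrite eq_sym eq_invg_mul -translD subrr transl0. Qed.

Lemma transl_inj : injective (@transl n p).
Proof.
move=> s h; have /injmP inj := injm_sdpair1 ('MR (GLrepr 'F_p n))%gact.
by apply: inj; rewrite inE.
Qed.

Lemma translJ t s : transl t ^ lin s = transl (t *m GLval s)%R.
Proof. by rewrite conjgE mulgA transl_conj. Qed.

Lemma mem_translations t : transl t \in translations n p.
Proof. by rewrite mem_morphim ?inE. Qed.

Lemma translationsP x : reflect (exists t, x = transl t) (x \in translations n p).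
Proof.
apply: (iffP idP) => [/morphimP[t _ _ ->] | [t ->]]; last exact: mem_translations.
by exists t.
Qed.

Lemma GLvalX s i : GLval (s ^+ i) = (GLval s ^+ i)%R.
Proof. exact: FinRing.val_unitX. Qed.

Lemma orbit_basisE s t : orbit_basis s t = basis_of fullv (krylov (GLval s) n.+1 t).
Proof. by congr basis_of; apply: eq_map => i; rewrite GLvalX. Qed.

Lemma GLval_negI : GLval (negI n p) = (- 1%:M)%R.
Proof. by []. Qed.

Lemma negI_central s : commute s (negI n p).
Proof. by apply: val_inj; rewrite /= mulrN mulNr mulr1 mul1r. Qed.

Lemma negI2 : negI n p ^+ 2 = 1.
Proof. by apply: val_inj; rewrite /= mulrNN mulr1. Qed.

Lemma negIJ t : transl t ^ lin (negI n p) = transl (- t)%R.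
Proof. by rewrite translJ GLval_negI mulmxN mulmx1. Qed.

Lemma sigma_ell2 t : sigma_ell t ^+ 2 = 1.
Proof.
rewrite /sigma_ell expg2 {1}(conjgC (transl t)) negIJ translN -mulgA mulKg -lin_morphM.
by rewrite -expg2 negI2 lin1.
Qed.

Lemma translZ (c : 'F_p) t : transl (c *: t)%R = transl t ^+ c.
Proof.
rewrite -{1}(natr_Zp c) scaler_nat; elim: (nat_of_ord c) => [|k IHk].
  by rewrite mulr0n transl0.
by rewrite mulrS translD IHk expgS.
Qed.

(** Horner's rule: multiplication by X is conjugation by [lin s], and adding a constant c multiplies
    by the c-th power of [transl t]. *)
Lemma transl_krylov (W : {group AGL n p}) s t (q : {poly 'F_p}) :
  lin s \in W -> transl t \in W -> transl (t *m horner_mx (GLval s) q)%R \in W.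
Proof.
move=> Ws Wt; elim/poly_ind: q => [|q c IHq].
  by rewrite rmorph0 mulmx0 transl0.
rewrite rmorphD rmorphM /= horner_mx_X horner_mx_C mulmxDr mulmxA translD.
by rewrite -translJ mul_mx_scalar translZ groupM ?groupX ?groupJ.
Qed.

Lemma AGLsub_lin s : lin s \in AGLsub s.
Proof. by rewrite /= (subsetP (joing_subr _ _)) // cycle_id. Qed.

Lemma AGLsub_transl s t : transl t \in AGLsub s.
Proof. by rewrite /= (subsetP (joing_subl _ _)) // mem_translations. Qed.

Lemma AGLsub_sigma_ell s t : negI n p \in <[s]> -> sigma_ell t \in AGLsub s.
Proof.
by case/cycleP=> i eN; rewrite /sigma_ell groupM ?AGLsub_transl // eN -linX groupX ?AGLsub_lin.
Qed.

Lemma AGLsub_alg_data s t : negI n p \in <[s]> -> orbit_basis s t ->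
  alg_data (AGLsub s) (lin s) (sigma_ell t).
Proof.
move=> sN; rewrite orbit_basisE => Bt; split; last first.
  exact: sigma_ell2.
apply/eqP; rewrite eqEsubset gen_subG; apply/andP; split.
  by apply/subsetP=> x /set2P[]->; rewrite ?AGLsub_lin ?AGLsub_sigma_ell.
have Gs : lin s \in <<[set lin s; sigma_ell t]>> by rewrite mem_gen ?set21.
(* [lin (negI n p)] is a power of [lin s], so it can be cancelled from [sigma_ell t]. *)
have Gt : transl t \in <<[set lin s; sigma_ell t]>>.
  have /cycleP[i eN] := sN.
  rewrite -(groupMr _ (groupX i Gs)) linX -eN mem_gen ?set22 //.
rewrite /= join_subG cycle_subG Gs andbT; apply/subsetP=> _ /translationsP[v ->].
have [q ->] := krylov_basis_gen v Bt.
exact: transl_krylov.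
Qed.

Lemma sigma_ellJ t h : sigma_ell t ^ lin h = sigma_ell (t *m GLval h)%R.
Proof.
rewrite /sigma_ell conjMg translJ; congr (_ * _).
by apply/conjg_fixP/commgP; rewrite /commute -!lin_morphM negI_central.
Qed.

Lemma linJ s h : lin s ^ lin h = lin (s ^ h).
Proof. by rewrite conjgE linV -!lin_morphM -conjgE. Qed.

Lemma AGLsubJ s h : AGLsub s :^ lin h = AGLsub (s ^ h).
Proof.
rewrite /= conjYg -cycleJ linJ; congr (_ <*> _); apply/setP=> x.
rewrite mem_conjg; apply/translationsP/translationsP=> [[t e] | [t ->]].
  by exists (t *m GLval h)%R; rewrite -translJ -e conjgKV.
by exists (t *m GLval h^-1)%R; rewrite linV translJ.
Qed.

Lemma sigma_map_conj s h t : negI n p \in <[s]> ->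
  omap_iso (sigma_map s t) (sigma_map (s ^ h) (t *m GLval h)%R).
Proof.
move=> sN; rewrite /sigma_map -linJ -sigma_ellJ.
apply: (@injm_alg_map_iso _ _ _ _ [morphism of conjgm (AGLsub s) (lin h)]).
- exact: injm_conj.
- by rewrite morphim_conj setIid AGLsubJ.
- exact: AGLsub_lin.
- exact: AGLsub_sigma_ell.
Qed.

End AffineGroup.

(** * Embedding into the affine group *)

(** The subgroup [H] generated by the class is normalised by [<[r]>], and [H * <[r]>] contains [r]
    and [l], so it is [X]; Dedekind's law then gives [T = H]. *)
Lemma cyclic_complement_gen (gT : finGroupType) (X T : {group gT}) (r l x : gT) :
  T ><| <[r]> = X -> <<[set r; l]>> = X -> x \in T -> x^-1 * l \in <[r]> ->
  <<x ^: <[r]> >> = T.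
Proof.
move=> defX genX Tx Crl; have [_ mulTC nTC tiTC] := sdprodP defX.
pose H := <<x ^: <[r]> >>%G; rewrite -[LHS]/(H : {set gT}).
have nHC : <[r]> \subset 'N(H).
  by rewrite norms_gen // class_norm.
have sHT : H \subset T by rewrite gen_subG class_sub_norm.
have sXH : X \subset H * <[r]>.
  rewrite -genX -norm_joinEr // gen_subG; apply/subsetP=> y /set2P[]->.
    by rewrite mem_gen // inE cycle_id orbT.
  suff: l \in H * <[r]> by rewrite -norm_joinEr.
  by rewrite -[l](mulKVg x) mem_mulg // mem_gen // class_refl.
apply/eqP; rewrite eqEsubset sHT /=; apply: subset_trans (_ : T :&: (H * <[r]>) \subset _).
  by rewrite subsetI subxx (subset_trans _ sXH) // -mulTC mulG_subl.
by rewrite setIC -group_modl // [<[r]> :&: _]setIC tiTC mulg1.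
Qed.

Section AffineEmbedding.

Variables (p n : nat) (gT : finGroupType) (X T : {group gT}) (r l : gT).
Hypotheses (p_pr : prime p) (abelT : p.-abelem T) (cardT : #|T| = (p ^ n.+1)%N).
Hypotheses (defX : T ><| <[r]> = X) (genX : <<[set r; l]>> = X) (l2 : l ^+ 2 = 1).
Hypothesis corefree :
  forall B : {group gT}, B \subset <[r]> -> X \subset 'N(B) -> B :=: 1.

Lemma cyclic_complement_faithful : 'C_<[r]>(T) = 1.
Proof.
have [_ mulTC nTC tiTC] := sdprodP defX.
apply: corefree; first exact: subsetIl.
have nTB : T \subset 'N('C_<[r]>(T)) by apply: cents_norm; rewrite centsC subsetIr.
have nCB : <[r]> \subset 'N('C_<[r]>(T)).
  by apply: sub_abelian_norm; rewrite ?cycle_abelian ?subsetIl.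
by rewrite -mulTC mulG_subG; apply/andP.
Qed.

Lemma affine_embedding :
  exists s : {'GL_n.+1(p)}, exists2 t, s \in cyclicGL n p /\ orbit_basis s t &
    omap_iso (alg_map X r l) (sigma_map s t).
Proof.
have [_ mulTC nTC tiTC] := sdprodP defX.
have [sTX sCX] : T \subset X /\ <[r]> \subset X by rewrite -mulTC mulG_subl mulG_subr.
have Xr : r \in X by rewrite -cycle_subG.
have Xl : l \in X by rewrite -genX mem_gen ?set22.
have nTX : X \subset 'N(T) by rewrite -mulTC mulG_subG normG.
have ntT : T :!=: 1 by rewrite -cardG_gt1 cardT -(exp1n n.+1) ltn_exp2r ?prime_gt1.
(* The representation on [T] has degree [(abelem_dim' T).+1]; substituting for n makes the types
   agree. *)
have dimT : abelem_dim' T = n.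
  by apply: succn_inj; rewrite (dim_abelemE abelT ntT) cardT pfactorK.
subst n.
pose rT := abelem_repr abelT ntT nTX; pose vT := abelem_rV abelT ntT.
have vT_inj : {in T &, injective vT} by apply/injmP/abelem_rV_injm.
have vTJ : {in T & X, forall x y, vT (x ^ y) = (vT x *m rT y)%R}.
  exact: abelem_rV_J.
pose s : {'GL_(abelem_dim' T).+1(p)} := reprGLm rT r.
have sE i : GLval (s ^+ i) = rT (r ^+ i).
  by rewrite GLvalX repr_mxX // -(val_reprGLm rT Xr).
have fHM : {in T &, {morph (fun x => transl (vT x)) : x y / x * y}}.
  by move=> x y Tx Ty; rewrite /vT abelem_rV_M // translD.
pose fH := Morphism fHM.
have dvd_s : #[lin s] %| #[r].
  rewrite order_dvdn linX; apply/eqP; rewrite -(lin1 _ p); congr lin.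
  by apply: val_inj; rewrite -[LHS]/(GLval _) sE expg_order repr_mx1.
(* Faithfulness of the action on [T] gives this divisibility, which makes [fK] injective. *)
have dvd_r : #[r] %| #[lin s].
  rewrite order_dvdn; apply/eqP/set1gP; rewrite -cyclic_complement_faithful.
  rewrite inE mem_cycle; apply/centP=> x Tx; apply/commute_sym/commgP/conjg_fixP.
  have Txr : x ^ r ^+ #[lin s] \in T by rewrite memJ_norm // (subsetP nTX) ?groupX.
  apply: (vT_inj _ _ Txr Tx).
  rewrite vTJ ?groupX // -sE.
  have -> : s ^+ #[lin s] = 1 by apply: (@lin_inj _ p); rewrite -linX expg_order lin1.
  by rewrite mulmx1.
pose fK := [morphism of eltm dvd_s].
have actf : {in T & <[r]>, morph_act 'J 'J fH fK}.
  move=> x _ Tx /cycleP[i ->] /=.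
  by rewrite eltmE linX translJ sE vTJ ?groupX.
pose f := [morphism of sdprodm defX actf].
have im_fH : fH @* T = translations (abelem_dim' T) p.
  apply/setP=> y; apply/morphimP/translationsP => [[x _ Tx ->] | [t ->]].
    by exists (vT x).
  exists (rVabelem abelT ntT t); rewrite ?mem_rVabelem //=.
  by rewrite /vT rVabelemK.
have injf : 'injm f.
  rewrite injm_sdprodm injm_eltm dvd_r im_fH im_eltm.
  have [_ _ _ ->] := sdprodP (AGLsubE s); rewrite eqxx /= andbT.
  by apply/injmP=> x y Tx Ty /transl_inj/vT_inj; apply.
have imf : f @* X = AGLsub s.
  by rewrite im_sdprodm im_fH im_eltm (sdprodW (AGLsubE s)).
have fr : f r = lin s by rewrite /= sdprodmEr ?cycle_id //= eltm_id.
have /mulsgP[x c Tx Cc el] : l \in T * <[r]> by rewrite mulTC.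
pose t := vT x.
(* [l ^+ 2 = 1] equates [x * x ^ c^-1] in [T] with the inverse of [c ^+ 2] in [<[r]>], so both are
   trivial. *)
have xcV : x ^ c = x^-1 /\ c ^+ 2 = 1.
  have Txc : x ^ c^-1 \in T by rewrite memJ_norm // groupV (subsetP nTC).
  have e : x * x ^ c^-1 * c ^+ 2 = 1.
    by rewrite -l2 el !expg2 !mulgA -[x * c * x]mulgA [c * x]conjgCV !mulgA.
  have c2 : c ^+ 2 = 1.
    apply/set1gP; rewrite -tiTC inE [X in _ && X]groupX // andbT -groupV.
    have -> : (c ^+ 2)^-1 = x * x ^ c^-1 by apply: (mulIg (c ^+ 2)); rewrite e mulVg.
    by rewrite groupM.
  split=> //; move: e; rewrite c2 mulg1 => /eqP; rewrite -eq_invg_mul => /eqP e.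
  by rewrite -[in LHS](invgK x) conjVg e conjgKV.
have genT : <<x ^: <[r]> >> = T.
  by apply: cyclic_complement_gen defX genX Tx _; rewrite el mulKg.
have gent v : exists q, v = (t *m horner_mx (GLval s) q)%R.
  have : rVabelem abelT ntT v \in <<x ^: <[r]> >> by rewrite genT mem_rVabelem.
  case/gen_prodgP=> m [a xa ya].
  suff [q qE] : exists q, vT (\prod_i a i) = (t *m horner_mx (GLval s) q)%R.
    by exists q; rewrite -qE -ya /vT rVabelemK.
  (* A product of conjugates of x by powers of [r] becomes a sum of vectors t s^j. *)
  elim: m a xa {ya} => [|m IHm] a xa.
    by exists 0%R; rewrite big_ord0 rmorph0 mulmx0 /vT abelem_rV_1.
  have Ta i : a i \in T by rewrite -genT mem_gen.
  have [q qE] := IHm (fun i => a (lift ord0 i)) (fun i => xa _).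
  have /imsetP[_ /cycleP[j ->] a0] := xa ord0.
  exists ('X^j + q)%R; rewrite big_ord_recl /vT abelem_rV_M ?group_prod //.
  rewrite -/vT qE a0 vTJ ?groupX // -sE GLvalX rmorphD /= rmorphXn /= horner_mx_X.
  by rewrite mulmxDr.
have /cycleP[k ec] := Cc.
(* [s ^+ k] negates t and commutes with every q(s), so it negates all vectors t q(s), which are all
   vectors. *)
have sN : s ^+ k = negI (abelem_dim' T) p.
  apply: val_inj; apply/row_matrixP=> i; rewrite !rowE.
  have [q ->] := gent (delta_mx 0%R i).
  have eX : GLval (s ^+ k) = horner_mx (GLval s) 'X^k.
    by rewrite GLvalX rmorphXn /= horner_mx_X.
  rewrite -[\val _]/(GLval _) eX vhornerC -eX sE -ec -vTJ // ?(subsetP sCX) // xcV.1.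
  by rewrite /vT abelem_rV_V // [\val (negI _ _)]GLval_negI mulNmx mulmxN mulmx1.
have [degs Bt] := gen_krylov_basis gent.
exists s; exists t.
  split; last by rewrite orbit_basisE.
  by rewrite inE degs eqxx -sN mem_cycle.
rewrite /sigma_map -fr; have <- : f l = sigma_ell t; last exact: injm_alg_map_iso.
by rewrite /= el sdprodmE //= ec eltmE linX sN.
Qed.

End AffineEmbedding.

(** * Automorphism groups of regular Cayley maps *)

Local Notation rot := Defs.rot.
Local Notation rev := Defs.rev.

Section RegularMap.

Variable M : Defs.omap.
Hypothesis rot_darts : {in darts M, forall d, rot d \in darts M}.
Hypothesis rev_darts : {in darts M, forall d, rev d \in darts M}.
Hypothesis regM : regular_omap M.
Variable d0 : carrier M.
Hypothesis Dd0 : d0 \in darts M.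

Lemma omap_autP (f : {perm carrier M}) :
  reflect [/\ perm_on (darts M) f, {in darts M, forall d, f (rot d) = rot (f d)}
            & {in darts M, forall d, f (rev d) = rev (f d)}]
          (f \in omap_aut M).
Proof.
rewrite inE; apply: (iffP andP) => [[onf /forall_inP homf] | [onf rotf revf]].
  by split=> // d /homf/andP[/eqP rotf /eqP revf].
by split=> //; apply/forall_inP=> d Dd; rewrite rotf ?revf ?eqxx.
Qed.

Lemma omap_aut_group_set : group_set (omap_aut M).
Proof.
apply/group_setP; split; first by apply/omap_autP; split; rewrite ?perm_on1 // => d _; rewrite !perm1.
move=> f g /omap_autP[onf rotf revf] /omap_autP[ong rotg revg].
apply/omap_autP; split=> [|d Dd|d Dd]; first exact: perm_onM.
  by rewrite !permM rotf // rotg // (perm_closed _ onf).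
by rewrite !permM revf // revg // (perm_closed _ onf).
Qed.

Definition omap_aut_group := Group omap_aut_group_set.
Local Notation A := omap_aut_group.

Lemma aut_dart a : a \in A -> a d0 \in darts M.
Proof. by case/omap_autP=> ona _ _; rewrite (perm_closed _ ona). Qed.

Lemma aut_rot a d : a \in A -> d \in darts M -> a (rot d) = rot (a d).
Proof. by case/omap_autP=> _ + _; apply. Qed.

Lemma aut_rev a d : a \in A -> d \in darts M -> a (rev d) = rev (a d).
Proof. by case/omap_autP=> _ _; apply. Qed.

Lemma aut_inj a b : a \in A -> b \in A -> a d0 = b d0 -> a = b.
Proof.
move=> Aa Ab eab; apply/eqP; rewrite eq_mulgV1; apply/eqP/set1gP.
rewrite -(regM.2 d0 Dd0) inE [_ \in _](groupM Aa (groupVr Ab)) /=; apply/astab1P.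
by rewrite /= /aperm permM eab permK.
Qed.

Lemma aut_exists d : d \in darts M -> exists2 a, a \in A & a d0 = d.
Proof.
have trA : [transitive A, on darts M | 'P] := regM.1.
by move=> Dd; have [a Aa ->] := atransP2 trA Dd0 Dd; exists a.
Qed.

(* The inverse of r appears because the automorphism taking d0 to [rot d] acts
   as r first, whereas darts of an algebraic map are multiplied on the right. *)
Lemma regular_omap_alg (r l : {perm carrier M}) : r \in A -> l \in A ->
  r d0 = rot d0 -> l d0 = rev d0 -> omap_iso M (alg_map A r^-1 l^-1).
Proof.
move=> Ar Al rd0 ld0.
(* By regularity exactly one automorphism takes [d0] to a given dart; [f] returns its inverse, and
   the default 1 only occurs outside the darts. *)
pose f d := if [pick a in A | a d0 == d] is Some a then a^-1 else 1.
have fP d : d \in darts M -> f d \in A /\ (f d)^-1 d0 = d.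
  rewrite /f; case: pickP => [a /andP[Aa /eqP ad0] _ | noa]; first by rewrite groupV invgK.
  by case/aut_exists=> a Aa ad0; have:= noa a; rewrite /= [_ \in _]Aa ad0 eqxx.
have fA d : d \in darts M -> f d \in A by case/fP.
have fd d : d \in darts M -> (f d)^-1 d0 = d by case/fP.
have f_uniq d a : d \in darts M -> a \in A -> a^-1 d0 = d -> f d = a.
  move=> Dd Aa e; apply: invg_inj; apply: aut_inj; rewrite ?groupV ?fA //.
  by rewrite fd.
exists f; split=> [x y Dx Dy e | | d Dd | d Dd] /=.
- by rewrite -(fd x Dx) e fd.
- apply/setP=> a; apply/imsetP/idP=> [[d Dd ->] | Aa]; first exact: fA.
  have Da : a^-1 d0 \in darts M by rewrite aut_dart ?groupV.
  by exists (a^-1 d0) => //; rewrite (f_uniq _ a).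
- apply: f_uniq; rewrite ?rot_darts ?groupM ?groupV ?fA //.
  by rewrite invMg invgK permM rd0 aut_rot ?groupV ?fA // fd.
- apply: f_uniq; rewrite ?rev_darts ?groupM ?groupV ?fA //.
  by rewrite invMg invgK permM ld0 aut_rev ?groupV ?fA // fd.
Qed.

Lemma aut_iter_rot (r : {perm carrier M}) a i : r \in A -> a \in A ->
  r d0 = rot d0 -> (r ^+ i * a) d0 = iter i (@Defs.rot M) (a d0).
Proof.
move=> Ar Aa rd0; elim: i a Aa => [|i IHi] a Aa; first by rewrite mul1g.
rewrite expgS -mulgA permM rd0 aut_rot ?groupM ?groupX //=.
by rewrite IHi.
Qed.

End RegularMap.

(** * Translations and rotation in a regular Cayley map of an abelian group *)

Section CayleyMaps.

Variables (gT : finGroupType) (S : {set gT}) (rho : {perm gT}).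
Hypotheses (dataS : cayley_data S rho) (cGG : abelian [set: gT]).
Let M := cayley_map S rho.
Hypothesis regM : regular_omap M.

Lemma cayley_dart g s : ((g, g * s) \in darts M) = (s \in S).
Proof. by rewrite inE /= mulKg. Qed.

Lemma cayley_dartP (d : gT * gT) :
  reflect (exists g, exists2 s, s \in S & d = (g, g * s)) (d \in darts M).
Proof.
case: d => x y; apply: (iffP idP) => [| [g [s Ss ->]]]; last by rewrite cayley_dart.
by rewrite inE /= => Sxy; exists x, (x^-1 * y); rewrite ?mulKVg.
Qed.

Let rho_S s : s \in S -> rho s \in S.
Proof. by case: dataS => _ _ _ onrho _ Ss; rewrite (perm_closed _ onrho). Qed.

Let S_inv s : (s^-1 \in S) = (s \in S).
Proof. by case: dataS => _ SV _ _ _; rewrite -mem_invg SV. Qed.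

Lemma cayley_rot g s : @Defs.rot M (g, g * s) = (g, g * rho s).
Proof. by rewrite /= mulKg. Qed.

Lemma cayley_iter_rot g s i : iter i (@Defs.rot M) (g, g * s) = (g, g * (rho ^+ i) s).
Proof.
elim: i => [|i IHi]; first by rewrite perm1.
by rewrite iterS IHi cayley_rot expgSr permM.
Qed.

Lemma cayley_iter_rot_onto g s s' : s \in S -> s' \in S ->
  exists i, iter i (@Defs.rot M) (g, g * s) = (g, g * s').
Proof.
case: dataS => _ _ _ _ orbS Ss; rewrite -(orbS s Ss) => /porbitP[i ->].
by exists i; rewrite cayley_iter_rot.
Qed.

Lemma cayley_rot_darts : {in darts M, forall d, rot d \in darts M}.
Proof.
by move=> _ /cayley_dartP[g [s Ss ->]]; rewrite cayley_rot cayley_dart rho_S.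
Qed.

Lemma cayley_rev_darts : {in darts M, forall d, rev d \in darts M}.
Proof. by move=> d; rewrite !inE /= -S_inv invMg invgK. Qed.

(** Left translation, made the identity off the darts because [omap_aut] requires support in the
    darts. *)
Let transl_fun (g : gT) (d : gT * gT) : gT * gT :=
  if d \in darts M then (g * d.1, g * d.2) else d.

Let transl_fun_darts g d : (transl_fun g d \in darts M) = (d \in darts M).
Proof.
rewrite /transl_fun; case: ifP => // Dd; rewrite -Dd !inE /=.
by rewrite invMg -mulgA mulKg.
Qed.

Let transl_fun_inj g : injective (transl_fun g).
Proof.
move=> d e Ede; have := transl_fun_darts g d; rewrite Ede transl_fun_darts => eD.
move: Ede; rewrite /transl_fun eD; case: ifP => // _.
by case: d e {eD} => [d1 d2] [e1 e2] [/mulgI-> /mulgI->].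
Qed.

Definition cayley_transl g : {perm gT * gT} := perm (@transl_fun_inj g).
Local Notation L := cayley_transl.
Local Notation A := (omap_aut_group M).

Lemma cayley_translE g h s : s \in S -> L g (h, h * s) = (g * h, g * h * s).
Proof. by rewrite permE /transl_fun cayley_dart -mulgA => ->. Qed.

Lemma cayley_transl_aut g : L g \in A.
Proof.
apply/omap_autP; split=> [|d Dd|d Dd].
- apply/subsetP=> d; rewrite inE permE /transl_fun.
  by case: ifP => //; rewrite eqxx.
- case/cayley_dartP: Dd => h [s Ss ->].
  by rewrite cayley_rot !cayley_translE ?rho_S // cayley_rot.
- by rewrite !permE /transl_fun Dd cayley_rev_darts.
Qed.

(** Permutations compose from left to right, so left translation reverses products; commutativity
    turns it into a homomorphism. *)
Lemma cayley_translM : {in [set: gT] &, {morph L : g h / g * h}}.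
Proof.
move=> g h _ _; apply/permP=> d; rewrite permM.
have [Dd | D'd] := boolP (d \in darts M); last first.
  by rewrite !permE /transl_fun !(negPf D'd).
case/cayley_dartP: Dd => k [s Ss ->]; rewrite !cayley_translE // !mulgA.
by rewrite (centsP cGG g _ h) ?inE.
Qed.

Canonical cayley_transl_morphism := Morphism cayley_translM.

Variable s0 : gT.
Hypothesis Ss0 : s0 \in S.
Let d0 : carrier M := (1, s0).
Let Ed0 : d0 = (1, 1 * s0). Proof. by rewrite mul1g. Qed.
Let Dd0 : d0 \in darts M. Proof. by rewrite Ed0 cayley_dart. Qed.

Let translL g : L g d0 = (g, g * s0).
Proof. by rewrite Ed0 cayley_translE // mulg1. Qed.

Variables r l : {perm gT * gT}.
Hypotheses (Ar : r \in A) (Al : l \in A) (rd0 : r d0 = rot d0) (ld0 : l d0 = rev d0).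
Local Notation G := (L @* [set: gT]).

Let r_pow i : (r ^+ i) d0 = (1, (rho ^+ i) s0).
Proof.
rewrite -[r ^+ i]mulg1 (aut_iter_rot Dd0) // perm1 Ed0 cayley_iter_rot.
by rewrite !mul1g.
Qed.

Lemma cayley_transl_inj : 'injm L.
Proof.
apply/injmP=> g h _ _ /(congr1 (fun a : {perm gT * gT} => (a d0).1)).
by rewrite /= !translL.
Qed.

(** A power of [r] followed by a translation takes [d0] to any given dart. By regularity this
    describes every [a^-1], and inverting puts the factors in the stated order. *)
Lemma cayley_factor : G * <[r]> = A.
Proof.
apply/eqP; rewrite eqEsubset mulG_subG cycle_subG [_ \in _]Ar andbT.
apply/andP; split; first by apply/subsetP=> _ /morphimP[g _ _ ->]; apply: cayley_transl_aut.
apply/subsetP=> a Aa.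
have /cayley_dartP[g [s Ss e]] := aut_dart Dd0 (groupVr Aa).
have [i ei] := cayley_iter_rot_onto 1 Ss0 Ss.
have ea : a^-1 = r ^+ i * L g.
  apply: (aut_inj regM Dd0); rewrite ?groupM ?groupV ?groupX ?cayley_transl_aut //.
  rewrite (aut_iter_rot Dd0) ?cayley_transl_aut // translL e.
  by move: ei; rewrite !cayley_iter_rot => -[]; rewrite !mul1g => ->.
rewrite -[a]invgK ea invMg mem_mulg ?groupV ?mem_cycle //.
by rewrite mem_morphim ?inE.
Qed.

Lemma cayley_factor_TI : G :&: <[r]> = 1.
Proof.
apply/trivgP/subsetP=> _ /setIP[/morphimP[g _ _ ->] /cycleP[i e]].
have := congr1 (fun a : {perm gT * gT} => (a d0).1) e.
by rewrite /= translL r_pow /= => ->; rewrite morph1 group1.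
Qed.

Lemma cayley_rev2 : l ^+ 2 = 1.
Proof.
apply: (aut_inj regM Dd0); rewrite ?groupX //.
by rewrite permM ld0 (aut_rev Al) // ld0 perm1.
Qed.

(** [W] reaches every dart from [d0]: powers of [r] turn around a vertex and [l] crosses an edge, so
    [W] follows any word in [S], which generates the group. Regularity then gives [W = A]. *)
Lemma cayley_gen : <<[set r; l]>> = A.
Proof.
apply/eqP; rewrite eqEsubset gen_subG; apply/andP; split.
  by apply/subsetP=> a /set2P[]->.
pose W := <<[set r; l]>>%G; have Wr : r \in W by rewrite mem_gen ?set21.
have Wl : l \in W by rewrite mem_gen ?set22.
have sWA w : w \in W -> w \in A.
  by apply: subsetP; rewrite gen_subG; apply/subsetP=> a /set2P[]->.
have [_ _ genS _ _] := dataS.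
suff Wd g s : s \in S -> exists2 w, w \in W & w d0 = (g, g * s).
  apply/subsetP=> a Aa; have /cayley_dartP[g [s Ss e]] := aut_dart Dd0 Aa.
  have [w Ww wE] := Wd g s Ss.
  by rewrite (aut_inj regM Dd0 Aa (sWA w Ww)) // e wE.
have spin w h s1 s2 : w \in W -> s1 \in S -> s2 \in S -> w d0 = (h, h * s1) ->
    exists2 w', w' \in W & w' d0 = (h, h * s2).
  move=> Ww Ss1 Ss2 e; have [i ei] := cayley_iter_rot_onto h Ss1 Ss2.
  exists (r ^+ i * w); first by rewrite groupM ?groupX.
  by rewrite (aut_iter_rot Dd0) ?sWA // e.
have /gen_prodgP[m [c Sc ->]] : g \in <<S>> by rewrite genS inE.
elim: m c Sc s => [|m IHm] c Sc s Ss.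
  by rewrite big_ord0; apply: (spin 1 1 s0) => //; rewrite perm1 Ed0.
rewrite big_ord_recr /=; set h := \prod_(i < m) _; set s1 := c _.
have Ss1 : s1 \in S by apply: Sc.
have [w Ww e] := IHm (fun i => c (widen_ord (leqnSn m) i)) (fun i => Sc _) s1 Ss1.
have Wlw : l * w \in W by rewrite groupM.
have Ss1V : s1^-1 \in S by rewrite S_inv.
have elw : (l * w) d0 = (h * s1, h * s1 * s1^-1).
  by rewrite permM ld0 (aut_rev (sWA w Ww)) // e mulgK.
exact: spin Wlw Ss1V Ss elw.
Qed.

(** Conjugates of elements of [B] are powers of [r] and fix the base vertex, so [B] fixes every
    vertex; fixing both ends of [d0], it fixes [d0] and is trivial. *)
Lemma cayley_corefree (B : {group {perm gT * gT}}) :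
  B \subset <[r]> -> A \subset 'N(B) -> B :=: 1.
Proof.
move=> sBr nBA; have fix1 b d : b \in B -> d \in darts M -> (b d).1 = d.1.
  move=> Bb /(aut_exists regM Dd0)[a Aa <-].
  have Bb' : b ^ a^-1 \in B by rewrite memJ_norm // (subsetP nBA) ?groupV.
  have /cycleP[i ei] := subsetP sBr _ Bb'.
  have -> : b (a d0) = (r ^+ i * a) d0 by rewrite -ei -conjgCV permM.
  rewrite (aut_iter_rot Dd0) //; have /cayley_dartP[g [s _ ->]] := aut_dart Dd0 Aa.
  by rewrite cayley_iter_rot.
apply/trivgP/subsetP=> b Bb; have Ab : b \in A.
  have /cycleP[i ->] := subsetP sBr b Bb; exact: groupX.
apply/set1gP/(aut_inj regM Dd0) => //; rewrite perm1.
have e1 := fix1 b d0 Bb Dd0; have := fix1 b _ Bb (cayley_rev_darts Dd0).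
by rewrite (aut_rev Ab) // => /= e2; rewrite [LHS]surjective_pairing e1 e2.
Qed.

(** When [s0] has square 1, the reversed dart [(s0, 1)] is the translate of [d0] by [s0]. *)
Lemma cayley_rev_transl : s0 ^+ 2 = 1 -> l \in G.
Proof.
move=> s02; suff -> : l = L s0 by rewrite mem_morphim ?inE.
apply: (aut_inj regM Dd0); rewrite ?cayley_transl_aut //.
by rewrite ld0 translL -expg2 s02.
Qed.

End CayleyMaps.

Lemma regular_cayley_sigma_map (p n : nat) (gT : finGroupType) (S : {set gT}) (rho : {perm gT}) :
  prime p -> [set: gT] \isog [set: 'rV['F_p]_n.+1] ->
  cayley_data S rho -> regular_omap (cayley_map S rho) ->
  exists s : {'GL_n.+1(p)}, exists2 t, s \in cyclicGL n p /\ orbit_basis s t &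
    omap_iso (cayley_map S rho) (sigma_map s t).
Proof.
move=> p_pr isoG dataS regM.
have abelG : p.-abelem [set: gT] by rewrite (isog_abelem isoG) mx_Fp_abelem.
have cardG : #|[set: gT]| = (p ^ n.+1)%N.
  by rewrite (card_isog isoG) cardsT card_mx card_Fp // mul1n.
have cGG := abelem_abelian abelG.
have [s0 Ss0] : exists s0, s0 \in S.
  apply/set0Pn; apply: contraTneq isT => S0.
  have [_ _ genS _ _] := dataS.
  have : 1 < #|[set: gT]| by rewrite cardG -(exp1n n.+1) ltn_exp2r ?prime_gt1.
  by rewrite -genS S0 gen0 cards1.
have Dd0 : (1, s0) \in darts (cayley_map S rho).
  by rewrite -[s0]mul1g cayley_dart.
have rotD := cayley_rot_darts dataS; have revD := cayley_rev_darts dataS.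
have [r Ar rd0] := aut_exists regM Dd0 (rotD _ Dd0).
have [l Al ld0] := aut_exists regM Dd0 (revD _ Dd0).
have isoA := regular_omap_alg rotD revD regM Dd0 Ar Al rd0 ld0.
have l2 := cayley_rev2 regM Ss0 Al ld0.
have lV : l^-1 = l by apply/eqP; rewrite eq_invg_mul -expg2 l2.
rewrite lV in isoA; set A := omap_aut_group _ in isoA Ar Al.
have core (B : {group {perm gT * gT}}) :
    B \subset <[r^-1]> -> A \subset 'N(B) -> B :=: 1.
  by rewrite cycleV; apply: (cayley_corefree dataS regM Ss0 Ar rd0).
have genA : <<[set r^-1; l]>> = A.
  rewrite -(cayley_gen dataS regM Ss0 Ar Al rd0 ld0); apply/eqP; rewrite eqEsubset !gen_subG.
  apply/andP; split; apply/subsetP=> a /set2P[]->; rewrite ?[l \in _]mem_gen ?set22 //.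
    by rewrite groupV mem_gen ?set21.
  by rewrite -groupV mem_gen ?set21.
pose G := (cayley_transl_morphism S rho cGG @* [set: gT])%G.
have injL := cayley_transl_inj rho cGG Ss0.
have Gl : p = 2 -> l \in G.
  move=> p2; apply: (cayley_rev_transl dataS cGG regM Ss0 Al ld0).
  by rewrite -p2; case/(abelemP p_pr): abelG => _; apply; rewrite inE.
have factA : G * <[r^-1]> = A by rewrite cycleV; apply: (cayley_factor dataS cGG regM Ss0 Ar rd0).
have tiA : G :&: <[r^-1]> = 1 by rewrite cycleV; apply: (cayley_factor_TI cGG Ss0 Ar rd0).
have abelG' : p.-abelem G by apply: morphim_abelem.
have [T abelT defA] := factor_normal_complement p_pr abelG' factA tiA genA l2 core Gl.
have cardT : #|T| = (p ^ n.+1)%N.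
  rewrite -cardG -(card_injm injL) //; apply/eqP.
  rewrite -(eqn_pmul2r (cardG_gt0 <[r^-1]>%G)) (sdprod_card defA) -factA.
  by rewrite TI_cardMg.
have [s [t st isoT]] := affine_embedding p_pr abelT cardT defA genA l2 core.
by exists s, t => //; apply: omap_iso_trans isoA isoT.
Qed.

(** * Isomorphisms between affine maps *)

(** Normalise the dart bijection [g] to [f] with [f 1 = 1]. The elements [w] with
    [g (x * w) = g x * f w] for all [x] form a subgroup containing [r] and [l], hence [X]. *)
Lemma alg_map_iso_injm (aT rT : finGroupType) (X : {group aT}) (Y : {group rT}) r l r' l' :
  alg_data X r l -> omap_iso (alg_map X r l) (alg_map Y r' l') ->
  exists2 f : {morphism X >-> rT}, 'injm f & f r = r' /\ f l = l'.
Proof.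
move=> [genX _] [g [/= injg _ gr gl]].
have Xr : r \in X by rewrite -genX mem_gen ?set21.
have Xl : l \in X by rewrite -genX mem_gen ?set22.
pose f x := (g 1)^-1 * g x.
have fr : f r = r' by rewrite /f -{1}[r]mul1g gr // mulKg.
have fl : f l = l' by rewrite /f -{1}[l]mul1g gl // mulKg.
have gM : {in X &, forall x w, g (x * w) = g x * f w}.
  have grW : group_set [set w in X | [forall x in X, g (x * w) == g x * f w]].
    apply/group_setP; split=> [|w v].
      by rewrite inE group1; apply/forall_inP=> x _; rewrite /f mulVg !mulg1.
    rewrite !inE => /andP[Xw /forall_inP gw] /andP[Xv /forall_inP gv].
    rewrite groupM //; apply/forall_inP=> x Xx.
    rewrite mulgA (eqP (gv _ _)) ?groupM // (eqP (gw _ _)) //.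
    by rewrite /f (eqP (gv _ _)) // /f !mulgA.
  have : X \subset Group grW.
    rewrite -{1}genX gen_subG; apply/subsetP=> w /set2P[]->; rewrite inE ?Xr ?Xl /=.
      by apply/forall_inP=> x Xx; rewrite gr // fr.
    by apply/forall_inP=> x Xx; rewrite gl // fl.
  move=> /subsetP sX x w Xx /sX; rewrite inE => /andP[_ /forall_inP gw].
  exact/eqP/gw.
have fM : {in X &, {morph f : x w / x * w}}.
  by move=> x w Xx Xw; rewrite /f gM // /f mulgA.
exists (Morphism fM).
  by apply/injmP=> x w Xx Xw /mulgI; apply: injg.
by [].
Qed.

Lemma cyclic_involution_uniq (gT : finGroupType) (s x y : gT) :
  x \in <[s]> -> y \in <[s]> -> #[x] = 2 -> #[y] = 2 -> x = y.
Proof.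
move=> sx sy ox oy.
have eqxy : <[x]> == <[y]>.
  by rewrite (eq_subG_cyclic (cycle_cyclic s)) ?cycle_subG // -!orderE ox oy.
have := cycle_id x; rewrite (eqP eqxy) cycle2g // => /set2P[x1|//].
by rewrite x1 order1 in ox.
Qed.

Section Conjugacy.

Variables n p : nat.
Local Notation V := 'rV['F_p]_n.+1.
Implicit Types (s h : {'GL_n.+1(p)}) (t u v : V).

Lemma GL_conj s1 s2 (H : 'M['F_p]_n.+1) : H \in unitmx ->
  (GLval s1 *m H = H *m GLval s2)%R -> exists2 h, s2 = s1 ^ h & GLval h = H.
Proof.
move=> uH e; pose h : {'GL_n.+1(p)} := FinRing.unit _ uH; exists h => //.
have eh : s1 * h = h * s2 by apply: val_inj.
by rewrite conjgE eh mulKg.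
Qed.

Lemma sigma_map_iso_basis s t u : negI n p \in <[s]> -> orbit_basis s t -> orbit_basis s u ->
  omap_iso (sigma_map s t) (sigma_map s u).
Proof.
rewrite !orbit_basisE => sN Bt Bu.
have [H [uH cH tH]] := krylov_basis_conj Bt Bu.
have [h es eh] := GL_conj uH cH.
by have := sigma_map_conj h t sN; rewrite -es eh tH.
Qed.

(** The vector t h multiplied by q(s^h) is t q(s) h, so t h is again cyclic. *)
Lemma orbit_basisJ s t h : orbit_basis s t -> orbit_basis (s ^ h) (t *m GLval h)%R.
Proof.
rewrite !orbit_basisE => Bt.
have eh : (GLval h *m GLval (s ^ h) = GLval s *m GLval h)%R.
  by have /(congr1 val) := esym (conjgC s h).
move: (GLval (s ^ h)) eh => A eh.
have kr q : (t *m GLval h *m horner_mx A q =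
             t *m horner_mx (GLval s) q *m GLval h)%R.
  elim/poly_ind: q => [|q c IHq]; first by rewrite !rmorph0 !mulmx0 mul0mx.
  rewrite !rmorphD !rmorphM /= !horner_mx_X !horner_mx_C !mulmxDr mulmxDl !mulmxA IHq.
  by rewrite -[in LHS](mulmxA _ (GLval h)) eh !mul_mx_scalar -scalemxAl !mulmxA.
apply: (gen_krylov_basis _).2 => w.
have [q qE] := krylov_basis_gen (w *m GLval h^-1)%R Bt.
exists q; rewrite kr -qE -mulmxA.
have -> : (GLval h^-1 *m GLval h = 1%:M)%R by have /(congr1 val) := mulVg h.
by rewrite mulmx1.
Qed.

Lemma sigma_map_iso_conj s1 s2 t1 t2 :
  s1 \in cyclicGL n p -> s2 \in cyclicGL n p ->
  orbit_basis s1 t1 -> orbit_basis s2 t2 ->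
  omap_iso (sigma_map s1 t1) (sigma_map s2 t2) -> exists h, s2 = s1 ^ h.
Proof.
rewrite !inE => /andP[_ sN1] /andP[_ sN2] B1 B2 iso12.
have [f injf [fr fl]] := alg_map_iso_injm (AGLsub_alg_data sN1 B1) iso12.
have Xs := AGLsub_lin s1; have Xt v := AGLsub_transl s1 v.
have /injmP f_inj := injf.
(* [f] sends -I to a power of [s2] of order 2, and a cyclic group has only one involution; when -I =
   I both sides are trivial. *)
have fN : f (lin (negI n p)) = lin (negI n p).
  have /cycleP[k eN] := sN1.
  have XN : lin (negI n p) \in AGLsub s1 by rewrite eN -linX groupX.
  have fk : f (lin (negI n p)) = lin (s2 ^+ k).
    by rewrite eN -!linX morphX // fr.
  rewrite fk; congr lin; have [N1 | ntN] := eqVneq (negI n p) 1.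
    by apply: (@lin_inj n p); rewrite -fk N1 lin1 morph1.
  apply: (@cyclic_involution_uniq _ s2); rewrite ?mem_cycle //.
    apply: nt_prime_order => //.
      by apply: (@lin_inj n p); rewrite -linX -fk -morphX // linX negI2 lin1 morph1.
    apply: contraNneq ntN => s2k; apply/eqP/(@lin_inj n p)/f_inj; rewrite ?lin1 //.
    by rewrite morph1 fk s2k lin1.
  by apply: nt_prime_order => //; apply: negI2.
have ft : f (transl t1) = transl t2.
  have XN : lin (negI n p) \in AGLsub s1.
    by have /cycleP[k ->] := sN1; rewrite -linX groupX.
  by apply: (mulIg (lin (negI n p))); rewrite -{1}fN -morphM.
have fkr q : f (transl (t1 *m horner_mx (GLval s1) q)%R) =
             transl (t2 *m horner_mx (GLval s2) q)%R.
  elim/poly_ind: q => [|q c IHq]; first by rewrite !rmorph0 !mulmx0 !transl0 morph1.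
  rewrite !rmorphD !rmorphM /= !horner_mx_X !horner_mx_C !mulmxDr !mulmxA !translD.
  rewrite -!translJ !mul_mx_scalar !translZ morphM ?groupX ?groupJ // morphJ // morphX //.
  by rewrite IHq fr ft.
rewrite !orbit_basisE in B1 B2.
have [q qE] := fin_all_exists (fun i => krylov_basis_gen (delta_mx 0%R i) B1).
(* Each standard basis vector t1 q(s1) is sent to t2 q(s2), so by [fkr] this is the matrix of [f] on
   translations. *)
pose H := (\matrix_i (t2 *m horner_mx (GLval s2) (q i)))%R.
have fH v : f (transl v) = transl (v *m H)%R.
  rewrite (row_sum_delta v); elim/big_ind: _ => [|u w IHu IHw|i _].
  - by rewrite mul0mx !transl0 morph1.
  - by rewrite mulmxDl !translD morphM // IHu IHw.
  - by rewrite -scalemxAl !translZ morphX // {1}qE fkr -rowE rowK.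
have uH : H \in unitmx.
  rewrite -row_free_unit; apply: inj_row_free => v vH0.
  apply: (@transl_inj n p); apply: f_inj; rewrite ?Xt //.
  by rewrite !fH vH0 mul0mx.
have cH : (GLval s1 *m H = H *m GLval s2)%R.
  apply/row_matrixP=> i; rewrite !rowE !mulmxA; apply: (@transl_inj n p).
  by rewrite -fH -[RHS]translJ -fH -translJ morphJ // fr.
by have [h] := GL_conj uH cH; exists h.
Qed.

End Conjugacy.

Theorem theorem1p2 (p n : nat) (p_prime : prime p)
    (M : {set {'GL_n.+1(p)}}) (M_reps : class_reps M) :
  [/\ forall s : {'GL_n.+1(p)}, s \in M ->
        (exists t, orbit_basis s t) /\
        (forall t, orbit_basis s t ->
           alg_data (AGLsub s) (lin s) (sigma_ell t)),
      forall (gT : finGroupType) (S : {set gT}) (rho : {perm gT}),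
        [set: gT] \isog [set: 'rV['F_p]_n.+1] ->
        cayley_data S rho ->
        regular_omap (cayley_map S rho) ->
        exists2 s : {'GL_n.+1(p)}, s \in M &
          forall t, orbit_basis s t ->
            omap_iso (cayley_map S rho) (sigma_map s t) &
      forall s1 s2 : {'GL_n.+1(p)}, s1 \in M -> s2 \in M -> s1 <> s2 ->
        forall t1 t2, orbit_basis s1 t1 -> orbit_basis s2 t2 ->
          ~ omap_iso (sigma_map s1 t1) (sigma_map s2 t2)].
Proof.
have /and3P[_ /subsetP sM /forall_inP M1] := M_reps.
have rep s : s \in cyclicGL n p -> exists u, M :&: s ^: 'GL_n.+1(p) = [set u].
  by move=> cs; apply/cards1P/M1/imset_f.
split=> [s Ms | gT S rho isoG dataS regM | s1 s2 Ms1 Ms2 s12 t1 t2 B1 B2 iso12].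
- have := sM s Ms; rewrite inE => /andP[/eqP degs sN]; split=> [|t]; last exact: AGLsub_alg_data.
  have [t annt] := cyclic_vector (GLval s).
  by exists t; rewrite orbit_basisE; apply: basis_krylov.
- have [s0 [t0 [cs0 Bt0] iso0]] := regular_cayley_sigma_map p_prime isoG dataS regM.
  have [s es] := rep s0 cs0.
  have : s \in M :&: s0 ^: 'GL_n.+1(p) by rewrite es set11.
  case/setIP=> Ms /imsetP[h _ sE]; exists s => // t Bt.
  move: (cs0); rewrite inE => /andP[_ sN0].
  move: (sM s Ms); rewrite inE => /andP[_ sN].
  (* First conjugate [s0] to its representative, then replace the transported cyclic vector by the
     given [t]. *)
  apply: omap_iso_trans iso0 _; apply: omap_iso_trans (sigma_map_conj h t0 sN0) _.
  by rewrite -sE; apply: sigma_map_iso_basis => //; rewrite sE; apply: orbit_basisJ.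
have [h s2E] := sigma_map_iso_conj (sM _ Ms1) (sM _ Ms2) B1 B2 iso12.
have [s es] := rep s1 (sM _ Ms1).
have : s1 \in M :&: s1 ^: 'GL_n.+1(p) by rewrite inE Ms1 class_refl.
have : s2 \in M :&: s1 ^: 'GL_n.+1(p) by rewrite inE Ms2 s2E memJ_class ?inE.
by rewrite es => /set1P e2 /set1P e1; apply: s12; rewrite e1 e2.
Qed.
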